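(* Let $\Delta$ be a $\delta$-sequence. Then there exist finitely many nested families of $\delta$-sequences $\mathcal{D}=\{\Delta_i\}_{i\ge 0}$ with $\Delta_0=\Delta$ such that $S_{\Delta_i}=S_\Delta$ for all $i\ge 0$ and such that, for all $i$, the first element $\delta_0(\Delta_{i+1})$ of $\Delta_{i+1}$ is either equal to the first element $\delta_0(\Delta_i)$ of $\Delta_i$ or not a multiple of $\delta_0(\Delta_i)$. Furthermore, the cardinality of any such family $\mathcal{D}$ is finite.
   Context: $\mathbb{N}$ denotes the non-negative integers, and $\langle r_0,\ldots,r_m\rangle=\mathbb{N}r_0+\cdots+\mathbb{N}r_m$ is the semigroup generated by $r_0,\ldots,r_m$. For a finite sequence $\Lambda=(r_0,\ldots,r_m)$ of positive integers put $d_i(\Lambda)=\gcd(r_0,\ldots,r_{i-1})$ for $1\le i\le m+1$, $n_i(\Lambda)=d_i(\Lambda)/d_{i+1}(\Lambda)$ for $1\le i\le m$, and $n_0(\Lambda)=1$. A sequence $\Delta=(\delta_0,\ldots,\delta_g)$ of positive integers with $g>0$ is a $\delta$-sequence if, with $d_i=d_i(\Delta)$ and $n_i=n_i(\Delta)$: (a) $d_{g+1}=1$ and $n_i>1$ for $1\le i\le g$; (b) $n_i\delta_i\in\langle\delta_0,\ldots,\delta_{i-1}\rangle$ for $1\le i\le g$; (c) $\delta_i<n_{i-1}\delta_{i-1}$ for $1\le i\le g$. By convention the one-term sequence $T=(1)$ is also a $\delta$-sequence (with $g=0$). $S_\Delta=\langle\delta_0,\ldots,\delta_g\rangle$ is the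 semigroup generated by $\Delta$, and $\delta_0(\Delta)$ denotes the first element of $\Delta$. Let $\Delta=(\delta_i)_{i=0}^g$ and $\Delta'=(\delta_i')_{i=0}^{g'}$ be $\delta$-sequences. $\Delta'$ is a refinement of $\Delta$ if there are indices $0\le i_0<i_1<\cdots<i_g\le g'$ with $\delta'_{i_j}=\delta_j$ for all $0\le j\le g$; the order of the refinement is the cardinality of the set $\Delta'\setminus\Delta$. A nested family of $\delta$-sequences is a (finite or infinite) sequence $\{\Delta_i\}_{i\ge 0}$ of $\delta$-sequences such that each $\Delta_{i+1}$ is a refinement of order $1$ of $\Delta_i$. *)

(* Defs.v *)
From mathcomp Require Import all_boot.
From mathcomp Require Import boolp classical_sets cardinality.

Set Implicit Arguments.
Unset Strict Implicit.
Unset Printing Implicit Defensive.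

Local Open Scope classical_set_scope.
Local Open Scope nat_scope.

(* A sequence (r_0, ..., r_m) is the list [:: r_0; ...; r_m], so that
   [size L = m + 1]; the notation [nth 0 L i] stands for r_i. *)

Definition semigroup (L : seq nat) : set nat :=
  [set x | exists a : nat -> nat, x = \sum_(i < size L) a i * nth 0 L i].

(* Only the indices 1 <= i <= size L are meaningful. *)
Definition dgcd (L : seq nat) (i : nat) : nat := \big[gcdn/0]_(r <- take i L) r.

(* The division is exact: dgcd L i.+1 divides dgcd L i. *)
Definition nquo (L : seq nat) (i : nat) : nat :=
  if i == 0 then 1 else dgcd L i %/ dgcd L i.+1.

Definition delta_sequence_pos (D : seq nat) : Prop :=
  let g := (size D).-1 in
  [/\ 0 < g,
      forall i, i <= g -> 0 < nth 0 D i,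
      dgcd D g.+1 = 1 /\ (forall i, 1 <= i <= g -> 1 < nquo D i),
      forall i, 1 <= i <= g -> semigroup (take i D) (nquo D i * nth 0 D i)
    & forall i, 1 <= i <= g -> nth 0 D i < nquo D i.-1 * nth 0 D i.-1].

Definition delta_sequence (D : seq nat) : Prop :=
  D = [:: 1] \/ delta_sequence_pos D.

Definition refinement (D D' : seq nat) : Prop :=
  exists2 idx : 'I_(size D) -> 'I_(size D'),
    forall j k : 'I_(size D), j < k -> idx j < idx k
  & forall j : 'I_(size D), nth 0 D' (idx j) = nth 0 D j.

(* Cardinality of the set D' \ D of terms of D' that are not terms of D. *)
Definition refinement_order (D D' : seq nat) : nat :=
  size (undup [seq x <- D' | x \notin D]).

(* A finite or infinite sequence {D_i}_{i >= 0} is a partial function on nat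
   whose domain is a nonempty initial segment: [F i = None] means that the
   family stops before the index i. *)
Record nested_family (F : nat -> option (seq nat)) : Prop := NestedFamily {
  nested_start : F 0 <> None;
  nested_initial : forall i, F i.+1 <> None -> F i <> None;
  nested_delta : forall i D, F i = Some D -> delta_sequence D;
  nested_refine : forall i D D', F i = Some D -> F i.+1 = Some D' ->
    refinement D D' /\ refinement_order D D' = 1
}.

Definition admissible_families (Delta : seq nat) :
    set (nat -> option (seq nat)) :=
  [set F | [/\ nested_family F,
      F 0 = Some Delta,
      forall i D, F i = Some D -> semigroup D = semigroup Delta
    & forall i D D', F i = Some D -> F i.+1 = Some D' ->
        head 0 D' = head 0 D \/ ~~ (head 0 D %| head 0 D')]].

(* Main.v *)
Require Import Defs.
From mathcomp Require Import all_boot zify.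
From mathcomp Require Import boolp classical_sets cardinality.

(** A delta-sequence D freely generates its semigroup S, and the number
    [\sum_(i >= 1) (n_i - 1) delta_i - delta_0] is not in S.  As S contains every
    n >= c for some c, this number is less than c.  When a new head x that is
    not a multiple of the old head h is inserted, [(n_1 - 1) h >= 2 x - h], so x plus
    the sum of all entries after h is less than c + h: both x and the earlier
    heads are bounded.  Finally the head bounds everything else, as
    [d_i delta_i <= delta_0 ^ 2]; since each refinement adds an entry, only
    finitely many families, all of bounded length, are left. *)

Set Implicit Arguments.
Unset Strict Implicit.

Local Open Scope classical_set_scope.
Local Open Scope nat_scope.

(** * Semigroups and gcds of finite sequences *)

Lemma semigroup_rcons (L : seq nat) (r x : nat) :
  semigroup (rcons L r) x <-> exists y a, semigroup L y /\ x = y + a * r.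
Proof.
have sumE (f : nat -> nat) : \sum_(i < size (rcons L r)) f i * nth 0 (rcons L r) i
    = \sum_(i < size L) f i * nth 0 L i + f (size L) * r.
  rewrite size_rcons big_ord_recr /= nth_rcons ltnn eqxx; congr (_ + _).
  by apply: eq_bigr => i _; rewrite nth_rcons ltn_ord.
split=> [[f ->]|[y [a [[f ->] ->]]]].
  rewrite sumE; exists (\sum_(i < size L) f i * nth 0 L i), (f (size L)).
  by split=> //; exists f.
pose f' i := if i == size L then a else f i.
exists f'; rewrite sumE /f' eqxx.
by congr (_ + _); apply: eq_bigr => i _; rewrite ltn_eqF.
Qed.

Lemma semigroupD (L : seq nat) (x y : nat) :
  semigroup L x -> semigroup L y -> semigroup L (x + y).
Proof.
case=> a -> [b ->]; exists (fun i => a i + b i).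
by rewrite -big_split; apply: eq_bigr => i _; rewrite mulnDl.
Qed.

Lemma semigroupMl (L : seq nat) (k x : nat) : semigroup L x -> semigroup L (k * x).
Proof.
case=> a ->; exists (fun i => k * a i).
by rewrite big_distrr; apply: eq_bigr => i _; rewrite /= mulnA.
Qed.

Lemma dgcd_rcons (L : seq nat) (r : nat) :
  dgcd (rcons L r) (size (rcons L r)) = gcdn (dgcd L (size L)) r.
Proof. by rewrite /dgcd !take_size big_rcons. Qed.

Lemma dgcd_take (L : seq nat) (k : nat) : k <= size L ->
  dgcd (take k L) (size (take k L)) = dgcd L k.
Proof. by move=> kL; rewrite /dgcd take_size. Qed.

Lemma dgcdS (L : seq nat) (i : nat) : i < size L ->
  dgcd L i.+1 = gcdn (dgcd L i) (nth 0 L i).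
Proof. by move=> iL; rewrite /dgcd (take_nth 0) // big_rcons. Qed.

Lemma dgcd0 (L : seq nat) : dgcd L 0 = 0.
Proof. by rewrite /dgcd take0 big_nil. Qed.

Lemma dvdn_semigroup (L : seq nat) (x : nat) :
  semigroup L x -> dgcd L (size L) %| x.
Proof.
elim/last_ind: L x => [|L r IH] x.
  by case=> a ->; rewrite big_ord0.
case/semigroup_rcons=> y [a [/IH yL ->]]; rewrite dgcd_rcons.
apply: dvdn_add; first exact: dvdn_trans (dvdn_gcdl _ _) yL.
exact: dvdn_mull (dvdn_gcdr _ _).
Qed.

(** Induction on the generators: fewer than [d] copies of the last one, [r], bring [n] to a multiple
    of the previous gcd [d]. *)
Lemma semigroup_large (L : seq nat) : (forall r, r \in L -> 0 < r) ->
  exists c, forall n, c <= n -> dgcd L (size L) %| n -> semigroup L n.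
Proof.
elim/last_ind: L => [|L r IH] Lpos.
  exists 0 => n _; rewrite dgcd0 dvd0n => /eqP->.
  by exists (fun=> 0); rewrite big_ord0.
have r_gt0 : 0 < r by apply: Lpos; rewrite mem_rcons mem_head.
have [c Hc] : exists c, forall n, c <= n -> dgcd L (size L) %| n -> semigroup L n.
  by apply: IH => s sL; apply: Lpos; rewrite mem_rcons inE sL orbT.
rewrite dgcd_rcons; set d := dgcd L (size L) in Hc *.
(* The gcd of no generators is 0, so this case covers the first generator. *)
have [d0|d_gt0] := posnP d.
  exists 0 => n _; rewrite d0 gcd0n => /dvdnP[q ->].
  apply/semigroup_rcons; exists 0, q; split=> //.
  by exists (fun=> 0); rewrite big1.
exists (c + d * r) => n cn /dvdnP[q nE].
case: (egcdnP d r_gt0) => km kn def_d _.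
(* By Bezout, [q * km * r] is congruent to [n] modulo [d]. Reducing the coefficient modulo [d] keeps
   this and ensures [n - b * r >= c]. *)
set b := (q * km) %% d.
have b_lt : b < d by rewrite ltn_pmod.
have brn : b * r <= d * r by rewrite leq_mul2r ltnW ?orbT.
apply/semigroup_rcons; exists (n - b * r), b; split; last by lia.
apply: Hc; first by lia.
have qE : q * km = (q * km) %/ d * d + b by exact: divn_eq.
have : n - b * r + q * kn * d = (q * km) %/ d * r * d.
  have: n + q * kn * d = q * km * r.
    by rewrite -[q * km * r]mulnA def_d nE gcdnC; lia.
  rewrite {1}qE; set t := _ %/ _; nia.
move=> E; have := dvdn_mull ((q * km) %/ d * r) (dvdnn d).
by rewrite -E dvdn_addl // dvdn_mull.
Qed.

(** * Delta-sequences: size bounds and Frobenius number *)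

(** A common form of both alternatives, indexed by positions below [size D], so that [[:: 1]] needs
    no separate treatment. *)
Record weak_delta (D : seq nat) : Prop := WeakDelta {
  wd_size : 0 < size D;
  wd_pos : forall i, i < size D -> 0 < nth 0 D i;
  wd_gcd : dgcd D (size D) = 1;
  wd_nquo : forall i, 0 < i < size D -> 1 < nquo D i;
  wd_mem : forall i, 0 < i < size D -> semigroup (take i D) (nquo D i * nth 0 D i);
  wd_lt : forall i, 0 < i < size D -> nth 0 D i < nquo D i.-1 * nth 0 D i.-1
}.

Lemma delta_sequence_weak (D : seq nat) : delta_sequence D -> weak_delta D.
Proof.
case=> [->|[]].
  split=> //=; try by case=> [|[]].
  by rewrite /dgcd big_cons big_nil.
move=> g_gt0; have sE : size D = (size D).-1.+1 by rewrite prednK //; lia.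
set g := (size D).-1 in g_gt0 sE *.
move=> p [d n] m l; split.
- by rewrite sE.
- by move=> i; rewrite sE ltnS => /p.
- by rewrite sE.
- by move=> i; rewrite sE ltnS; apply: n.
- by move=> i; rewrite sE ltnS; apply: m.
- by move=> i; rewrite sE ltnS; apply: l.
Qed.

Section WeakDelta.
Variables (D : seq nat) (hD : weak_delta D).

Lemma dgcd_gt0 (i : nat) : 0 < i <= size D -> 0 < dgcd D i.
Proof.
elim: i => // -[_|i IH] /andP[_ iD].
  by rewrite dgcdS // dgcd0 gcd0n (wd_pos hD).
by rewrite dgcdS // gcdn_gt0 IH //= ltnW.
Qed.

Lemma nquoE (i : nat) : 0 < i < size D -> nquo D i * dgcd D i.+1 = dgcd D i.
Proof.
move=> /andP[i0 iD]; rewrite /nquo gtn_eqF // divnK //.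
by rewrite dgcdS // dvdn_gcdl.
Qed.

Lemma dvdn_dgcd_nth (i j : nat) : i < j <= size D -> dgcd D j %| nth 0 D i.
Proof.
elim: j => // j IH; rewrite ltnS => /andP[ij jD]; rewrite dgcdS //.
move: ij; rewrite leq_eqVlt => /orP[/eqP->|ij]; first exact: dvdn_gcdr.
by apply: dvdn_trans (dvdn_gcdl _ _) (IH _); rewrite ij ltnW.
Qed.

(** An entry repeated at position j is already divisible by d_j, which would give n_j = 1. *)
Lemma weak_delta_uniq : uniq D.
Proof.
apply/(uniqPn 0) => -[i [j [ij jD E]]].
have := wd_nquo hD (i := j); rewrite jD (leq_ltn_trans _ ij) // => /(_ isT).
have dj : dgcd D j %| nth 0 D j by rewrite -E dvdn_dgcd_nth // ij ltnW.
rewrite /nquo gtn_eqF ?(leq_ltn_trans _ ij) // dgcdS // (gcdn_idPl dj).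
by rewrite divnn; case: (0 < _).
Qed.

(* [d_i * delta_i] decreases with i, since d_i = n_i * d_(i+1). *)
Lemma dgcd_mul_le (i : nat) : 0 < i < size D ->
  dgcd D i * nth 0 D i <= nth 0 D 0 ^ 2.
Proof.
elim: i => // -[_|i IH] iD.
  have := wd_lt hD iD; rewrite /= /nquo mul1n dgcdS ?(wd_size hD) // dgcd0 gcd0n.
  by rewrite expnS expn1 leq_mul2l => /ltnW->; rewrite orbT.
have iD' : 0 < i.+1 < size D by case/andP: iD => _ /ltnW.
apply: leq_trans (IH iD'); have /ltnW /= := wd_lt hD iD.
by rewrite -(nquoE iD') [_ * dgcd _ _]mulnC -mulnA leq_mul2l => ->; rewrite orbT.
Qed.

Lemma nth_le_sqr (i : nat) : i < size D -> nth 0 D i <= nth 0 D 0 ^ 2.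
Proof.
case: i => [|i] iD; first by have := wd_pos hD iD; nia.
apply: leq_trans (dgcd_mul_le (i := i.+1) iD).
by rewrite leq_pmull // dgcd_gt0 //= ltnW.
Qed.

Lemma size_le_sqr : size D <= (nth 0 D 0 ^ 2).+1.
Proof.
rewrite -[X in _ <= X](size_iota 0); apply: uniq_leq_size weak_delta_uniq _ => x.
by move=> /(nthP 0)[i iD <-]; rewrite mem_iota /= add0n ltnS nth_le_sqr.
Qed.

(* Reduce an expression of the candidate Frobenius number modulo d_k: the
   coefficient of delta_k must be n_k - 1 plus a multiple of n_k, and (b)
   moves that multiple down to the earlier generators. *)
Lemma frobenius_notin_take (k y : nat) : k < size D -> semigroup (take k.+1 D) y ->
  \sum_(1 <= i < k.+1) (nquo D i).-1 * nth 0 D i <> nth 0 D 0 + y.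
Proof.
elim: k y => [|k IH] y kD.
  by move=> _; rewrite big_geq // => E; have := wd_pos hD kD; lia.
rewrite (take_nth 0) // => /semigroup_rcons[z [a [zS ->]]] E.
have kr : 0 < k.+1 < size D by [].
set d := dgcd D k.+1; set s := nth 0 D k.+1; set n := nquo D k.+1.
have n_gt1 : 1 < n := wd_nquo hD kr.
have d1_gt0 : 0 < dgcd D k.+2 by rewrite dgcd_gt0.
have dz : d %| z.
  by have := dvdn_semigroup zS; rewrite dgcd_take // ltnW.
have dns : d %| n * s.
  by have := dvdn_semigroup (wd_mem hD kr); rewrite dgcd_take // ltnW.
have d0 : d %| nth 0 D 0 by apply: dvdn_dgcd_nth; lia.
rewrite big_nat_recr //= -/n -/s -/d in E.
have dsum : d %| \sum_(1 <= i < k.+1) (nquo D i).-1 * nth 0 D i.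
  rewrite big_nat; apply: dvdn_sum => i /andP[i1 ik].
  by apply/dvdn_mull/dvdn_dgcd_nth; lia.
set S := \sum_(1 <= i < k.+1) _ in E dsum.
(* Adding [s] to both sides turns the coefficients [n - 1] and [a] into [n] and [a + 1]. *)
have E' : S + n * s = nth 0 D 0 + z + a.+1 * s.
  by rewrite -(ltn_predK n_gt1) !mulSn; lia.
have da : d %| a.+1 * s.
  have : d %| nth 0 D 0 + z + a.+1 * s by rewrite -E' dvdn_add.
  by rewrite dvdn_addr // dvdn_add.
have na : n %| a.+1.
  have g_gt0 : 0 < gcdn d s by rewrite -dgcdS.
  have -> : n = d %/ gcdn d s by rewrite -dgcdS.
  rewrite -(@Gauss_dvdl _ _ (s %/ gcdn d s)).
    rewrite -(dvdn_pmul2r g_gt0) -mulnA !divnK ?dvdn_gcdl ?dvdn_gcdr //.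
  rewrite /coprime -(eqn_pmul2r g_gt0) mul1n muln_gcdl.
  by rewrite !divnK ?dvdn_gcdl ?dvdn_gcdr.
have [t tE] : exists t, a.+1 = t.+1 * n.
  by case/dvdnP: na => -[|t] // ->; exists t.
(* One of the [t + 1] copies of [n * s] cancels against the left side; the other [t] lie in the
   semigroup of the earlier entries. *)
apply: (IH (z + t * (n * s))); first exact: ltnW.
  by apply: semigroupD => //; apply/semigroupMl/(wd_mem hD).
rewrite -/S; move: E'; rewrite tE mulSn mulnDl -mulnA.
by rewrite addnCA [in RHS]addnC => /eqP; rewrite eqn_add2r addnA => /eqP.
Qed.

Lemma frobenius_lt (c : nat) : (forall n, c <= n -> semigroup D n) ->
  \sum_(1 <= i < size D) (nquo D i).-1 * nth 0 D i < nth 0 D 0 + c.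
Proof.
move=> Hc; have sE : (size D).-1.+1 = size D by rewrite prednK // wd_size.
rewrite ltnNge; apply/negP => le.
set S := \sum_(1 <= i < _) _ in le.
apply: (@frobenius_notin_take (size D).-1 (S - nth 0 D 0)); rewrite ?sE //.
  by rewrite take_size; apply: Hc; lia.
by rewrite -/S; lia.
Qed.

(** The product n_1 delta_1 is the lcm of delta_0 and delta_1: a multiple of delta_0, and not
    delta_0 itself unless delta_1 divides it. *)
Lemma nquo1_not_dvd : 1 < size D -> ~~ (nth 0 D 1 %| nth 0 D 0) ->
  2 * nth 0 D 0 <= nquo D 1 * nth 0 D 1.
Proof.
move=> D1 nd; have D0 := ltnW D1.
have d1E : dgcd D 1 = nth 0 D 0 by rewrite dgcdS // dgcd0 gcd0n.
have /dvdnP[q qE] : dgcd D 2 %| nth 0 D 1 by rewrite dvdn_dgcd_nth.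
have nE := nquoE (i := 1) D1; rewrite d1E in nE.
have q_gt0 := wd_pos hD D1.
rewrite -nE mulnA [2 * _]mulnC -mulnA leq_mul2l; apply/orP; right.
case: q qE => [|[|q]] qE; first by rewrite qE in q_gt0.
  by move: nd; rewrite qE mul1n -nE dvdn_mull.
by rewrite qE leq_mul2r orbT.
Qed.

(** Meant for a new head delta_0 placed before an old head delta_1. In the Frobenius sum the first
    term is at least 2 delta_0 - delta_1, and each later delta_i counts at least once since n_i >
    1. *)
Lemma head_bound (c : nat) : (forall n, c <= n -> semigroup D n) ->
  1 < size D -> ~~ (nth 0 D 1 %| nth 0 D 0) ->
  nth 0 D 0 < c + nth 0 D 1 /\
  (forall i, 1 < i < size D -> nth 0 D 0 + nth 0 D i < c + nth 0 D 1).
Proof.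
move=> Hc D1 nd; have := frobenius_lt Hc.
rewrite big_ltn // => F; have := nquo1_not_dvd D1 nd.
have nE : nquo D 1 = (nquo D 1).-1.+1.
  by have := wd_nquo hD (i := 1) D1; case: nquo.
rewrite {1}nE mulSn => N; split; first by lia.
move=> i /andP[i1 iD].
have : nth 0 D i <= \sum_(2 <= i < size D) (nquo D i).-1 * nth 0 D i.
  rewrite (big_cat_nat i1 (ltnW iD)) /= [X in _ + X]big_ltn //.
  have : 1 < nquo D i by rewrite wd_nquo // iD andbT ltnW.
  case: nquo => [|[|m]] // _; apply: leq_trans (leq_addl _ _).
  by rewrite /= mulSn -addnA leq_addr.
by lia.
Qed.

End WeakDelta.

(** * Refinements of order one *)

Lemma refinement_size (D D' : seq nat) : weak_delta D -> refinement D D' ->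
  refinement_order D D' = 1 -> size D < size D'.
Proof.
move=> hD [idx _ idxE]; rewrite /refinement_order => o1.
have [x] : exists x, x \in [seq x <- D' | x \notin D].
  case E: [seq x <- D' | x \notin D] o1 => [|x s] //= _.
  by exists x; rewrite mem_head.
rewrite mem_filter => /andP[xD xD'].
apply: (@uniq_leq_size _ (x :: D)); first by rewrite /= xD weak_delta_uniq.
move=> y; rewrite inE => /orP[/eqP->|/(nthP 0)[i iD <-]] //.
by rewrite -(idxE (Ordinal iD)) mem_nth.
Qed.

(** If the old head moves, position 0 of [D'] holds the only new entry, so the old head sits at
    position 1 and the other old entries follow it. *)
Lemma refinement_head (D D' : seq nat) :
  weak_delta D -> weak_delta D' -> refinement D D' ->
  refinement_order D D' = 1 -> head 0 D' <> head 0 D ->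
  nth 0 D' 1 = head 0 D /\
  (forall i, 0 < i < size D -> exists2 j, 1 < j < size D' & nth 0 D' j = nth 0 D i).
Proof.
move=> hD hD' ref o1 hneq; have sz := refinement_size hD ref o1.
case: ref => idx idxS idxE; rewrite -!nth0 in hneq *.
have D0 := wd_size hD; have u' := weak_delta_uniq hD'.
pose o0 := Ordinal D0.
have idx0 : 0 < idx o0.
  by rewrite lt0n; apply/eqP => E; apply: hneq; rewrite -(idxE o0) E.
have idx_pos (j : 'I_(size D)) : o0 < j -> 1 < idx j.
  by move=> /idxS; apply: leq_ltn_trans.
have pre i : i < size D' -> nth 0 D' i \in D -> exists j, idx j = i :> nat.
  move=> iD' /(nthP 0)[j jD E]; exists (Ordinal jD).
  by apply/eqP; rewrite -(nth_uniq 0 _ iD' u') // idxE E.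
have D'1 : 1 < size D' by apply: leq_ltn_trans sz.
have idx_ge j : 0 < idx j.
  have [j0|/idx_pos/ltnW //] := posnP j.
  by rewrite (_ : j = o0) //; apply: val_inj.
have n0 : nth 0 D' 0 \notin D.
  apply/negP => /(pre _ (ltnW D'1))[j E]; by have := idx_ge j; rewrite E.
have /(pre _ D'1)[j jE] : nth 0 D' 1 \in D.
  (* Otherwise the first two entries of [D'] would both be new, against order one. *)
  case: (boolP (nth 0 D' 1 \in D)) => // n1.
  have : size [:: nth 0 D' 0; nth 0 D' 1] <= refinement_order D D'.
    apply: uniq_leq_size => [|x].
      by rewrite /= inE nth_uniq ?(ltnW D'1).
    rewrite !inE mem_undup mem_filter => /orP[] /eqP->.
      by rewrite n0 mem_nth // ltnW.
    by rewrite n1 mem_nth.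
  by rewrite o1.
split.
  rewrite -jE idxE; case: (posnP j) => [-> //|/idx_pos]; by rewrite jE.
move=> i /andP[i0 iD]; exists (idx (Ordinal iD)); last exact: idxE.
by rewrite idx_pos //=.
Qed.

(** * Uniform bounds on admissible families *)

Section FamilyBound.
Variables (Delta : seq nat) (F : nat -> option (seq nat)) (c : nat).
Hypothesis large : forall n, c <= n -> semigroup Delta n.
Hypothesis hF : admissible_families Delta F.

(* A head inserted on top of a head h that is itself not the original one
   pushes an older head beyond position 1; as the Frobenius number is
   fixed this forces h <= 2 * c, so heads never exceed h_0 + 3 * c. *)
Lemma family_invariant (i : nat) (D : seq nat) : F i = Some D ->
  i < size D /\
  (head 0 D = head 0 Delta \/
   exists j, [/\ 0 < j < size D, nth 0 D j < head 0 D, head 0 D <= nth 0 D j + c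
     & nth 0 D j = head 0 Delta \/ nth 0 D j <= 2 * c]).
Proof.
case: hF => nF F0 SF headF; elim: i D => [|i IH] D' FS.
  move: FS; rewrite F0 => -[<-]; split; last by left.
  exact/wd_size/delta_sequence_weak/(nested_delta nF F0).
case FE: (F i) => [D|]; last by case: (nested_initial nF (i := i)); rewrite ?FS.
have [iD inv] := IH _ FE.
have hD := delta_sequence_weak (nested_delta nF FE).
have hD' := delta_sequence_weak (nested_delta nF FS).
have [ref o1] := nested_refine nF FE FS.
have sz := refinement_size hD ref o1.
split; first exact: leq_ltn_trans sz.
have D'1 : 1 < size D' by apply: leq_ltn_trans sz; exact: wd_size.
have [heq|hneq] := eqVneq (head 0 D') (head 0 D).
  (* With the head unchanged, the witness entry survives and [idx] gives its new position. *)
  rewrite heq; case: inv => [|[j [/andP[j0 jD] lt le h]]]; [by left|right].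
  case: ref => idx idxS idxE; exists (idx (Ordinal jD)).
  rewrite idxE; split=> //; rewrite ltn_ord andbT.
  by apply: leq_ltn_trans (idxS (Ordinal (wd_size hD)) _ _).
case: (headF _ _ _ FE FS) => [/eqP|nd]; first by rewrite (negPf hneq).
have [n1 rest] := refinement_head hD hD' ref o1 (elimN eqP hneq).
have large' n : c <= n -> semigroup D' n.
  by move=> /large; rewrite (SF _ _ FS).
have [|b1 b2] := head_bound hD' large' D'1.
  by rewrite n1 nth0.
have lt0 := wd_lt hD' (i := 1) D'1.
rewrite /= /nquo mul1n -!nth0 n1 in lt0 b1 b2 *.
right; exists 1; rewrite n1 D'1; split=> //; first by lia.
(* Let h be the old head and x the new one. In the second case x + D_j < c + h and h <= D_j + c give
   x < 2c, while h < x by condition (c). *)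
rewrite nth0; case: inv => [->|[j [jD lt le _]]]; first by left.
have [k kD kE] := rest j jD; have := b2 k kD; rewrite kE => b3.
by right; rewrite nth0 in b3 lt0; lia.
Qed.

Lemma family_bound (i : nat) (D : seq nat) : F i = Some D ->
  let B := (head 0 Delta + 3 * c) ^ 2 in
  [/\ i < B.+1, size D <= B.+1 & forall x, x \in D -> x < B.+1].
Proof.
move=> FE B; have [iD inv] := family_invariant FE.
have hD : weak_delta D.
  by case: hF => nF _ _ _; exact: delta_sequence_weak (nested_delta nF FE).
have hB : nth 0 D 0 ^ 2 <= B.
  (* The head is h_0, or at most D_j + c with D_j = h_0 or D_j <= 2c; hence the constant h_0 +
     3c. *)
  rewrite leq_exp2r // nth0.
  by case: inv => [->|[j [_ _ le [E|le2]]]]; lia.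
have sB : size D <= B.+1 by apply: leq_trans (size_le_sqr hD) _.
split=> //; first exact: leq_trans iD sB.
move=> x /(nthP 0)[j jD <-]; rewrite ltnS.
exact: leq_trans (nth_le_sqr hD jD) hB.
Qed.

End FamilyBound.

(** * Finiteness of bounded objects and conclusion *)

Lemma finite_bounded_seqs (m k : nat) :
  finite_set [set s : seq nat | size s <= m /\ forall x, x \in s -> x < k].
Proof.
elim: m => [|m IH].
  apply: sub_finite_set (finite_set1 [::]) => s [].
  by case: s.
apply: sub_finite_set (_ : finite_set ([set [::]] `|`
  [set x :: s | x in `I_k & s in [set s : seq nat | size s <= m /\ forall x, x \in s -> x < k]])).
  case=> [|x s] [/= sm sk]; [by left|right].
  exists x; first by apply: sk; rewrite mem_head.
  by exists s => //; split=> // y ys; apply: sk; rewrite inE ys orbT.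
by rewrite finite_setU; split; [exact: finite_set1|exact: finite_image2].
Qed.

Lemma finite_bounded_families (T : Type) (A : set T) (N : nat) : finite_set A ->
  finite_set [set F : nat -> option T |
    forall i x, F i = Some x -> i < N /\ A x].
Proof.
move=> finA; elim: N => [|N IH].
  apply: sub_finite_set (finite_set1 (fun=> None)) => F HF /=.
  by apply/funext => i; case E: (F i) => [x|] //; case: (HF _ _ E).
(* A family is its value at 0 followed by a shifted family supported below [N]. *)
pose cons (p : option T) (F : nat -> option T) i := if i is j.+1 then F j else p.
have finO : finite_set ([set None] `|` [set Some x | x in A]).
  by rewrite finite_setU; split; [exact: finite_set1|exact: finite_image].
apply: sub_finite_set (finite_image2 cons finO IH) => F HF.
exists (F 0).
  by case E: (F 0) => [x|]; [right; exists x; [case: (HF _ _ E)|]|left].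
exists (fun i => F i.+1) => [i x /HF|]; first by case.
by apply/funext; case.
Qed.

Unset Implicit Arguments.

Theorem corollary5p6 (Delta : seq nat) (hDelta : delta_sequence Delta) :
  [/\ admissible_families Delta !=set0,
      finite_set (admissible_families Delta)
    & forall F : nat -> option (seq nat), admissible_families Delta F ->
        finite_set [set i : nat | F i <> None]].
Proof.
have hD := delta_sequence_weak hDelta.
have [c large] : exists c, forall n, c <= n -> semigroup Delta n.
  have [r /(nthP 0)[i iD <-]|c Hc] := @semigroup_large Delta; first exact: wd_pos.
  by exists c => n cn; apply: Hc; rewrite // (wd_gcd hD) dvd1n.
set B := (head 0 Delta + 3 * c) ^ 2.
have bnd F (HF : admissible_families Delta F) i D (FE : F i = Some D) :
    [/\ i < B.+1, size D <= B.+1 & forall x, x \in D -> x < B.+1].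
  exact: (family_bound large HF FE).
split.
(* The family consisting of [Delta] alone is admissible. *)
- exists (fun i => if i is 0 then Some Delta else None); split=> //.
  + by split=> //; case=> // D [<-].
  + by case=> // D [<-].
- apply: sub_finite_set (@finite_bounded_families _ _ B.+1
    (finite_bounded_seqs B.+1 B.+1)) => F HF i D FE.
  by have [] := bnd F HF i D FE.
- move=> F HF; apply: sub_finite_set (finite_II B.+1) => i /=.
  by case FE: (F i) => [D|] // _; have [] := bnd F HF i D FE.
Qed.
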